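(* Assume there are constants $m,M>0$, $p\ge1$, $r>0$ such that $$m\,\mathrm{dist}(x,E(t))^p\le W(t,x)\le M\,\mathrm{dist}(x,E(t))^p$$ for all $(t,x)\in[t_0,\infty)\times\mathbb{R}^n$ with $\mathrm{dist}(x,E(t))\le r$. Let $x(\cdot)$ be a solution of $\dot x(t)=f(t,x(t))$ on $[t_0,\infty)$, write $d(t):=\mathrm{dist}(x(t),E(t))$, and assume $d(t)\le r$ for all $t\ge t_0$. Assume that $$\frac{d}{dt}W(t,x(t))\le-a\,W(t,x(t))^\theta\quad\text{for a.e. }t\ge t_0,$$ where $a>0$ and $\theta>0$. (i) If $\theta=1$, then for all $t\ge t_0$, $W(t,x(t))\le W(t_0,x(t_0))e^{-a(t-t_0)}$, and consequently $$d(t)\le\Big(\frac Mm\Big)^{1/p}e^{-a(t-t_0)/p}d(t_0).$$ (ii) If $\theta>1$, then for all $t\ge t_0$, $$W(t,x(t))\le\Big(W(t_0,x(t_0))^{1-\theta}+a(\theta-1)(t-t_0)\Big)^{-1/(\theta-1)},$$ and consequently there exists a constant $C=C(a,\theta,m,M,W(t_0,x(t_0)))>0$ such that $$d(t)\le C(1+t-t_0)^{-1/[p(\theta-1)]}\quad\text{for all }t\ge t_0.$$ (When $W(t_0,x(t_0))=0$, the right-hand side of the bound on $W$ in (ii) is read as $0$.)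
   Context: Fix $t_0\ge 0$ and $f:[t_0,\infty)\times\mathbb{R}^n\to\mathbb{R}^n$ such that $t\mapsto f(t,x)$ is measurable for every $x$ and $x\mapsto f(t,x)$ is locally Lipschitz for a.e. $t\ge t_0$. A solution is a locally absolutely continuous $x:[t_0,\infty)\to\mathbb{R}^n$ with $\dot x(t)=f(t,x(t))$ for a.e. $t\ge t_0$. For nonempty $S$, $\mathrm{dist}(x,S)=\inf_{y\in S}\|x-y\|$. The equilibrium sets are $E(t):=\{x\in\mathbb{R}^n: f(t,x)=0\}$, assumed nonempty and closed for every $t\ge t_0$. For nonempty closed $A,B$ and $R>0$, $d_R^{\rm AW}(A,B):=\sup_{\|z\|\le R}|\mathrm{dist}(z,A)-\mathrm{dist}(z,B)|$. Standing assumption: there is a nonnegative $v_E\in L^1_{\mathrm{loc}}([t_0,\infty))$ such that for every $R>0$ and $t_0\le s\le t$, $d_R^{\rm AW}(E(t),E(s))\le\int_s^t v_E(\tau)\,d\tau$. The function $W:=V_1+\delta V_2$ ($\delta>0$ fixed) is built from $V_1,V_2:[0,\infty)\times\mathbb{R}^n\to[0,\infty)$ such that for every solution $x(\cdot)$ the maps $t\mapsto V_i(t,x(t))$ are locally absolutely continuous on $[t_0,\infty)$. *)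

(* Defs.v *)
From HB Require Import structures.
From mathcomp Require Import all_boot all_order all_algebra.
From mathcomp Require Import all_classical all_reals all_analysis measurable_realfun.

Set Implicit Arguments.
Unset Strict Implicit.
Unset Printing Implicit Defensive.

Import Order.TTheory GRing.Theory Num.Theory.
Import numFieldNormedType.Exports.

Local Open Scope classical_set_scope.
Local Open Scope ring_scope.

(* The library norm `|x| on 'rV_n is the sup norm. The Euclidean norm is used
   wherever its value matters (distances and the AW distance); the library norm
   only enters notions that do not depend on the choice of a norm on R^n:
   closedness, differentiability, absolute continuity, local Lipschitz
   continuity. *)
Definition enorm (R : realType) (n : nat) (x : 'rV[R]_n) : R :=
  Num.sqrt (\sum_(i < n) x 0 i ^+ 2).

Definition dist (R : realType) (n : nat) (x : 'rV[R]_n) (S : set 'rV[R]_n) : R :=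
  inf [set enorm (x - y) | y in S].

Definition dAW (R : realType) (n : nat) (rho : R) (A B : set 'rV[R]_n) : R :=
  sup [set `|dist z A - dist z B| | z in [set z | enorm z <= rho]].

Definition equilibria (R : realType) (n : nat) (f : R -> 'rV[R]_n -> 'rV[R]_n)
  (t : R) : set 'rV[R]_n := [set x | f t x = 0].

Definition abs_continuous (R : realType) (V : normedModType R) (a b : R)
    (u : R -> V) : Prop :=
  forall e : R, 0 < e -> exists2 delta : R, 0 < delta &
    forall (k : nat) (l r : 'I_k -> R),
      (forall i, a <= l i /\ l i <= r i /\ r i <= b) ->
      trivIset setT (fun i => [set` `]l i, r i[ ]) ->
      \sum_(i < k) (r i - l i) < delta ->
      \sum_(i < k) `|u (r i) - u (l i)| < e.

Definition loc_abs_continuous (R : realType) (V : normedModType R) (t0 : R)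
    (u : R -> V) : Prop :=
  forall a b : R, t0 <= a -> a <= b -> abs_continuous a b u.

(* [measurable] on R is Borel measurability in the library; Lebesgue
   measurability is measurability for the completed sigma-algebra. *)
Definition lebesgue_measurable_fun (R : realType) (D : set R) (u : R -> R)
    : Prop :=
  @measurable_fun _ _
    (g_sigma_algebraType (completed_algebra_gen (@lebesgue_measure R)))
    (measurableTypeR R) D u.

Definition locally_lipschitz (R : realType) (V W : normedModType R)
    (g : V -> W) : Prop :=
  forall x : V, exists2 U : set V, nbhs x U & [lipschitz g y | y in U].

(* Functions on [t0, +oo[ are total functions on R whose values before t0 are
   unconstrained. *)
Definition admissible_field (R : realType) (n : nat) (t0 : R)
    (f : R -> 'rV[R]_n -> 'rV[R]_n) : Prop :=
  (forall (x : 'rV[R]_n) (i : 'I_n),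
     lebesgue_measurable_fun `[t0, +oo[ (fun t => f t x 0 i)) /\
  {ae @lebesgue_measure R, forall t : R, t0 <= t -> locally_lipschitz (f t)}.

Definition is_solution (R : realType) (n : nat) (t0 : R)
    (f : R -> 'rV[R]_n -> 'rV[R]_n) (x : R -> 'rV[R]_n) : Prop :=
  loc_abs_continuous t0 x /\
  {ae @lebesgue_measure R, forall t : R, t0 <= t -> is_derive t 1 x (f t (x t))}.

(* The library's [locally_integrable] requires an open domain. *)
Definition L1loc (R : realType) (t0 : R) (v : R -> R) : Prop :=
  forall K : set R, K `<=` `[t0, +oo[ -> compact K ->
    (@lebesgue_measure R).-integrable K (EFin \o v).

Definition AW_regular (R : realType) (n : nat) (t0 : R)
    (E : R -> set 'rV[R]_n) : Prop :=
  exists v : R -> R,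
    [/\ forall t : R, t0 <= t -> 0 <= v t,
        L1loc t0 v &
        forall rho s t : R, 0 < rho -> t0 <= s -> s <= t ->
          dAW rho (E t) (E s) <=
            \int[@lebesgue_measure R]_(tau in `[s, t]) v tau].

Definition lyapunov (R : realType) (n : nat) (V1 V2 : R -> 'rV[R]_n -> R)
    (delta t : R) (x : 'rV[R]_n) : R :=
  V1 t x + delta * V2 t x.

(* Main.v *)
(* On any interval where w(t) = W(t, x(t)) stays positive, phi(w(t)) + a t is
   absolutely continuous, where phi' = y^-theta, and its a.e. derivative is
   nonpositive; hence it is nonincreasing, which integrates the differential
   inequality. That an absolutely continuous g with g' <= 0 a.e. is
   nonincreasing follows without Vitali coverings: cover the exceptional null
   set by an open U of small measure and cut [a, b], by Cousin's lemma, into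
   finitely many pieces that either lie in U, where absolute continuity bounds
   the total increment, or have increment at most eps times their length. *)
Require Import Defs.
From mathcomp Require Import all_boot all_order all_algebra lra.
From mathcomp Require Import all_classical all_reals all_analysis measurable_realfun.

Import Order.TTheory GRing.Theory Num.Theory.
Import numFieldNormedType.Exports.

Local Open Scope classical_set_scope.
Local Open Scope ring_scope.

(** * Partitions of a compact interval subordinate to a gauge *)

(** Supremum argument: let [c] be the supremum of the points reachable from [a] through good pieces.
    The gauge at [c] allows one step from a nearby reachable point to [c], and another step past [c]
    unless [c = b]. Each piece has its tag [t] at one of its endpoints. *)
Lemma cousin (R : realType) (a b : R) (good : R -> R -> Prop) : a <= b ->
  (forall t, a <= t <= b -> exists2 eta, 0 < eta &
    forall s, `|s - t| < eta ->
      (s <= t -> good s t) /\ (t <= s -> good t s)) ->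
  exists (k : nat) (u : nat -> R),
    [/\ u 0%N = a, u k = b, {homo u : i j / (i <= j)%N >-> i <= j} &
        forall i, (i < k)%N -> good (u i) (u i.+1)].
Proof.
move=> ab hgood.
(* The sequence is frozen at [t] from index [k] on, so that it is monotone on all of [nat] and
   appending a point only overwrites the tail. *)
pose chain t := exists (k : nat) (u : nat -> R),
    [/\ u 0%N = a, (forall i, (k <= i)%N -> u i = t),
        (forall i, u i <= u i.+1) &
        forall i, (i < k)%N -> good (u i) (u i.+1)].
have chain_step s t : s <= t -> good s t -> chain s -> chain t.
  move=> st gst [k [u [u0 uk uu gu]]].
  exists k.+1, (fun i => if (i <= k)%N then u i else t); split => //.
  - by move=> i; rewrite ltnNge => /negPf ->.
  - move=> i; case: (ltnP i k) => [/ltnW -> //|ki].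
    case: (leqP i k) => // ik.
    by have -> : i = k by [apply/anti_leq; rewrite ik ki]; rewrite uk.
  - move=> i; rewrite ltnS => ik; rewrite ik.
    case: ltnP => [/gu //|ki].
    by have -> : i = k by [apply/anti_leq; rewrite ik ki]; rewrite uk.
pose S := [set t | a <= t <= b /\ chain t].
have Sa : S a.
  split; first by rewrite lexx.
  by exists 0%N, (fun=> a).
have supS : has_sup S.
  by split; [exists a | exists b => t [/andP[]]].
pose c := sup S.
have ac : a <= c by apply: ub_le_sup => //; case: supS.
have cb : c <= b by apply: ge_sup; [exists a | move=> t [/andP[]]].
have [|eta eta0 hc] := hgood c; first by rewrite ac cb.
have chc : chain c.
  have [s Ss cs] := sup_adherent eta0 supS.
  have sc : s <= c by apply: ub_le_sup => //; case: supS.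
  have [|g _] := hc s; first by rewrite ler0_norm ?subr_le0 // opprB -/c in cs *; lra.
  by apply: (chain_step s) => //; [exact: g | case: Ss].
(* Half of [eta] keeps [s] inside the gauge of [c]; as [s] is reachable, [s <= c], which leaves only
   [b <= c]. *)
pose s := Num.min b (c + eta / 2).
have cs : c <= s by rewrite /s le_min cb /=; lra.
have se : s <= c + eta / 2 by rewrite /s ge_min lexx orbT.
have sb : s <= b by rewrite /s ge_min lexx.
have Ss : S s.
  split; first by rewrite (le_trans ac cs).
  apply: (chain_step c) => //.
  have [|_] := hc s; first by rewrite ger0_norm ?subr_ge0 //; lra.
  exact.
have sc : s <= c by apply: ub_le_sup => //; case: supS.
have bc : b = c.
  apply/eqP; rewrite eq_le cb andbT.
  by move: sc; rewrite {1}/s ge_min => /orP[//|]; lra.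
case: chc => k [u [u0 uk uu gu]]; exists k, u; split => //.
- by rewrite uk.
- exact/nondecreasing_seqP.
Qed.

(** * Absolute continuity *)

Lemma abs_continuous_sub (R : realType) (V : normedModType R) (a b c d : R)
    (u : R -> V) :
  a <= c -> d <= b -> abs_continuous a b u -> abs_continuous c d u.
Proof.
move=> ac db ACu e /ACu[delta delta0 H]; exists delta => // k l r lr.
apply: H => i; have [cl [? rd]] := lr i.
by rewrite (le_trans ac cl) (le_trans rd db).
Qed.

Lemma abs_continuous_id (R : realType) (a b : R) :
  @abs_continuous R R a b id.
Proof.
move=> e e0; exists e => // k l r lr _; congr (_ < _); apply: eq_bigr => i _.
by rewrite ger0_norm // subr_ge0; have [_ []] := lr i.
Qed.

(* Both the sum V1 + delta V2 and the function phi o w + c id are dominated in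
   this sense. *)
Lemma abs_continuous_dominated (R : realType) (U V W : normedModType R)
    (a b K : R) (u : R -> U) (v : R -> V) (h : R -> W) :
  0 < K -> abs_continuous a b u -> abs_continuous a b v ->
  (forall s t, a <= s -> s <= t -> t <= b ->
     `|h t - h s| <= K * (`|u t - u s| + `|v t - v s|)) ->
  abs_continuous a b h.
Proof.
move=> K0 ACu ACv hK e e0.
have e'0 : 0 < e / K / 2 by rewrite !divr_gt0.
have [d1 d10 H1] := ACu _ e'0; have [d2 d20 H2] := ACv _ e'0.
exists (Num.min d1 d2); first by rewrite lt_min d10.
move=> k l r lr tlr; rewrite lt_min => /andP[lt1 lt2].
have := H1 k l r lr tlr lt1; have := H2 k l r lr tlr lt2.
set S2 := \sum_(i < k) _; set S1 := \sum_(i < k) _ => S2e S1e.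
apply: (@le_lt_trans _ _ (K * (S1 + S2))).
  rewrite /S1 /S2 -big_split mulr_sumr; apply: ler_sum => i _.
  by apply: hK; have [? []] := lr i.
have -> : e = K * (e / K / 2 + e / K / 2) by rewrite -splitr mulrC divfK ?gt_eqF.
by rewrite ltr_pM2l // ltrD.
Qed.

(** * Monotonicity from the sign of the derivative almost everywhere *)

(** Near [t] the difference quotient is below [e]; multiplying by [s - t] gives one estimate on each
    side of [t], the form that [cousin] asks of a piece tagged at [t]. *)
Lemma derive_le0_lt (R : realType) (g : R -> R) (t e : R) : 0 < e ->
  derivable g t 1 -> derive1 g t <= 0 ->
  exists2 eta, 0 < eta & forall s, `|s - t| < eta ->
    (s <= t -> g t - g s <= e * (t - s)) /\
    (t <= s -> g s - g t <= e * (s - t)).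
Proof.
move=> e0 dg g0.
have : h^-1 *: (g (h + t) - g t) @[h --> 0^'] --> derive1 g t.
  rewrite derive1E; have := @derivableP _ _ _ g t 1 dg => -[] _ _.
  move: dg; rewrite /derivable /derive => dg.
  suff -> : (fun h => h^-1 *: (g (h + t) - g t)) =
            (fun h => h^-1 *: ((g \o shift t) (h *: 1) - g t)) by [].
  by apply/funext => h /=; rewrite /shift/= [h *: 1]mulr1.
move=> /cvgr_lt /(_ e) /(_ (le_lt_trans g0 e0)).
rewrite near_withinE => /nbhs_ballP[eta /= eta0 H].
exists eta => // s st.
have {H} : s != t -> (s - t)^-1 * (g s - g t) < e.
  move=> nst; have := H (s - t); rewrite /ball/= sub0r normrN => /(_ st).
  by rewrite subr_eq0 subrK => /(_ nst).
case: (ltgtP s t) => // [lt_st|lt_ts|->] H; last first.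
  by rewrite !subrr mulr0.
  split => // _; have := H isT.
  by rewrite mulrC ltr_pdivrMr ?subr_gt0 // => /ltW.
split => // _; have := H isT.
by rewrite mulrC ltr_ndivrMr ?subr_lt0 // => /ltW; lra.
Qed.

(** By finite additivity the total length is the measure of the union. This lets absolute continuity
    act on disjoint pieces inside an open set of small measure. *)
Lemma sum_itv_le_measure (R : realType) (k : nat) (l r : 'I_k -> R)
    (U : set R) : measurable U -> (forall i, l i <= r i) ->
  trivIset setT (fun i => [set` `]l i, r i[ ]) ->
  (forall i, [set` `]l i, r i[ ] `<=` U) ->
  ((\sum_(i < k) (r i - l i))%:E <= lebesgue_measure U)%E.
Proof.
move=> mU lr tlr lrU.
have -> : ((\sum_(i < k) (r i - l i))%:E =
  \sum_(i < k) (lebesgue_measure [set` `]l i, r i[ ]))%E.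
  rewrite -sumEFin; apply: eq_bigr => i _; rewrite lebesgue_measure_itv /= lte_fin.
  by case: ltgtP (lr i) => // -> _; rewrite subrr.
have mF (i : 'I_k) : measurable [set` `]l i, r i[ ] by exact: measurable_itv.
have mB : measurable (\big[setU/set0]_(i < k) [set` `]l i, r i[ ]).
  exact: bigsetU_measurable.
rewrite -measure_semi_additive_ord //.
apply: le_measure; rewrite ?inE //.
elim/big_ind : _ => [|A B AU BU|i _]; [exact: sub0set | by rewrite subUset | exact: lrU].
Qed.

Lemma abs_continuous_nonincreasing (R : realType) (a b : R) (g : R -> R) :
  a <= b -> @abs_continuous R R a b g ->
  {ae @lebesgue_measure R, forall t, a <= t <= b ->
     derivable g t 1 /\ derive1 g t <= 0} ->
  g b <= g a.
Proof.
move=> ab ACg [N [mN N0 gN]].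
apply/ler_addgt0Pr => e e0.
have e20 : 0 < e / 2 by rewrite divr_gt0.
have [delta delta0 ACd] := ACg _ e20.
have [U [oU NU UN]] : exists U : set R, [/\ open U, N `<=` U &
    (lebesgue_measure (U `\` N) < delta%:E)%E].
  by apply: lebesgue_regularity_outer => //; rewrite [X in (X < _)%E]N0 ltry.
have mU : measurable U by exact: open_measurable.
have Ud : (lebesgue_measure U < delta%:E)%E.
  rewrite (measureDI lebesgue_measure _ mN) // [X in (_ + X)%E](_ : _ = 0%E).
    by rewrite adde0.
  by apply: (subset_measure0 _ mN) => //; exact: measurableI.
(* Chosen so that [eps * (b - a) <= e / 2]; the added 1 keeps the denominator positive when
   [a = b]. *)
pose eps := e / 2 / (b - a + 1).
have eps0 : 0 < eps by rewrite divr_gt0 //; lra.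
pose bad s t := [set` `]s, t[ ] `<=` U.
have [|k [u [u0 uk uu gu]]] :=
  @cousin R a b (fun s t => bad s t \/ g t - g s <= eps * (t - s)) ab.
  (* A tag in [N] gets a gauge that stays inside [U]; any other tag gets the gauge of the derivative
     estimate. *)
  move=> t tab; have [Nt|Nt] := pselect (N t).
    have /nbhs_ballP[eta /= eta0 tU] : nbhs t U.
      by apply: open_nbhs_nbhs; split => //; exact: NU.
    exists eta => // s st; split => ts; left => x /=;
        rewrite in_itv /= => /andP[x1 x2]; apply: tU; rewrite /ball /=.
    - move: st; rewrite ler0_norm ?subr_le0 // => st.
      by rewrite ger0_norm ?subr_ge0 ?(ltW x2) //; lra.
    - move: st; rewrite ger0_norm ?subr_ge0 // => st.
      by rewrite ler0_norm ?subr_le0 ?(ltW x1) //; lra.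
  have [dg g0] : derivable g t 1 /\ derive1 g t <= 0.
    by apply: contrapT => ng; apply: Nt; apply: gN => /= /(_ tab).
  have [eta eta0 H] := derive_le0_lt _ _ _ _ eps0 dg g0.
  exists eta => // s /H[H1 H2]; split => /[dup] st; first by move=> /H1; right.
  by move=> /H2; right.
pose l (i : 'I_k) := u i.
(* Pieces not contained in [U] are collapsed to empty intervals, so the family stays indexed by all
   of ['I_k] and they contribute nothing. *)
pose r (i : 'I_k) := if `[< bad (u i) (u i.+1) >] then u i.+1 else u i.
have u_ge i : a <= u i by rewrite -u0 uu.
have lr i : l i <= r i by rewrite /l /r; case: ifP => // _; exact: uu.
have r_le i : r i <= u i.+1 by rewrite /r; case: ifP => // _; exact: uu.
have tlr : trivIset setT (fun i => [set` `]l i, r i[ ]).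
  apply/trivIsetP => i j _ _.
  wlog ij : i j / (i < j)%N.
    move=> H nij; have [/H|/H|/val_inj ij] := ltngtP i j; first exact.
      by rewrite setIC eq_sym; exact.
    by rewrite ij eqxx in nij.
  move=> _; rewrite -subset0 => x /= []; rewrite !in_itv /= => /andP[_ xr] /andP[lx _].
  by have := lt_trans lx xr; rewrite ltNge (le_trans (r_le i)) //; exact: uu.
have {}ACd : \sum_(i < k) `|g (r i) - g (l i)| < e / 2.
  apply: ACd => //.
    move=> i; split; first exact: u_ge.
    by split => //; rewrite (le_trans (r_le i)) // -uk uu.
  rewrite -lte_fin; apply: le_lt_trans Ud.
  apply: sum_itv_le_measure => // i; rewrite /r /l.
  by case: ifPn => [/asboolP //|_]; rewrite set_itvoo0.
have -> : g b = g a + \sum_(i < k) (g (u i.+1) - g (u i)).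
  rewrite -(big_mkord xpredT (fun i => g (u i.+1) - g (u i))) telescope_sumr //.
  by rewrite u0 uk addrC subrK.
rewrite lerD2l.
(* Each increment is controlled by one of the two summands, and the other is nonnegative. *)
have : \sum_(i < k) (g (u i.+1) - g (u i)) <=
    \sum_(i < k) (`|g (r i) - g (l i)| + eps * (u i.+1 - u i)).
  apply: ler_sum => i _; have ui : u i <= u i.+1 by exact: uu.
  have epsu : 0 <= eps * (u i.+1 - u i) by rewrite mulr_ge0 ?(ltW eps0) ?subr_ge0.
  rewrite /r /l; case: ifPn => [_|/asboolPn nb].
    by rewrite ler_wpDr // ler_norm.
  by have [//|] := gu i (ltn_ord i); rewrite subrr normr0 add0r.
rewrite [leRHS]big_split /= -mulr_sumr.
rewrite -(big_mkord xpredT (fun i => u i.+1 - u i)) telescope_sumr // u0 uk.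
have : eps * (b - a) <= e / 2.
  rewrite /eps -mulrA ler_piMr ?(ltW e20) //.
  by rewrite mulrC ler_pdivrMr; lra.
lra.
Qed.

(** * Integration of the differential inequality *)

Lemma dissipative_nonincreasing (R : realType) (a b c theta : R)
    (w : R -> R) :
  0 <= c -> @abs_continuous R R a b w ->
  {ae @lebesgue_measure R, forall t, a <= t <= b ->
     derivable w t 1 /\ derive1 w t <= - c * w t `^ theta} ->
  forall s t, a <= s -> s <= t -> t <= b -> w t <= w s.
Proof.
move=> c0 ACw aew s t as_ st tb; apply: abs_continuous_nonincreasing => //.
  exact: abs_continuous_sub ACw.
move: aew; apply: negligibleS => q; apply: contra_not => /= H /andP[sq qt].
have [|dw dw0] := H; first by rewrite (le_trans as_) ?(le_trans qt).
split => //; apply: le_trans dw0 _.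
by rewrite mulNr oppr_le0 mulr_ge0 ?powR_ge0.
Qed.

(** Positivity is assumed at [b] only: [w] is nonincreasing, so its values on the interval stay
    above [w b]. There [phi] is Lipschitz with constant [L], its derivative at [w b], because [phi']
    is nonincreasing; hence [phi] composed with [w] is absolutely continuous. *)
Lemma separable_comparison (R : realType) (a b c theta : R)
    (w phi : R -> R) :
  a <= b -> 0 <= c -> 0 <= theta -> @abs_continuous R R a b w ->
  (forall t, a <= t <= b -> 0 <= w t) -> 0 < w b ->
  (forall y : R, 0 < y -> is_derive y (1 : R) phi (y `^ (- theta))) ->
  {ae @lebesgue_measure R, forall t, a <= t <= b ->
     derivable w t 1 /\ derive1 w t <= - c * w t `^ theta} ->
  phi (w b) <= phi (w a) - c * (b - a).
Proof.
move=> ab c0 theta0 ACw w0 wb0 dphi aew.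
have wbw t : a <= t -> t <= b -> w b <= w t.
  by move=> at_ tb; exact: (dissipative_nonincreasing _ _ _ _ _ _ c0 ACw aew).
pose L := w b `^ (- theta).
have L0 : 0 < L by exact: powR_gt0.
have phi_incr y z : w b <= y -> y <= z -> 0 <= phi z - phi y <= L * (z - y).
  move=> wby yz.
  have y0 x : y <= x -> 0 < x by move=> yx; rewrite (lt_le_trans wb0) ?(le_trans wby).
  have [||x] := @MVT_segment R phi (fun x => x `^ (- theta)) y z yz.
  - by move=> x; rewrite in_itv /= => /andP[/ltW/y0 x0 _]; exact: dphi.
  - apply: derivable_within_continuous => x; rewrite in_itv /= => /andP[/y0 x0 _].
    by have [] := dphi x x0.
  rewrite in_itv /= => /andP[yx _] ->.
  rewrite mulr_ge0 ?powR_ge0 ?subr_ge0 //= ler_wpM2r ?subr_ge0 //.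
  rewrite /L !powRN lef_pV2 ?posrE ?powR_gt0 ?(y0 _ yx) //.
  apply: ge0_ler_powR; rewrite ?nnegrE ?(ltW wb0) ?(ltW (y0 _ yx)) //.
  exact: le_trans yx.
have phi_lip y z : w b <= y -> w b <= z -> `|phi z - phi y| <= L * `|z - y|.
  wlog yz : y z / y <= z.
    move=> H wy wz; have [/H|/ltW/H] := leP y z; first exact.
    by rewrite distrC [X in _ <= _ * X]distrC; exact.
  by move=> wy _; have /andP[? ?] := phi_incr y z wy yz; rewrite !ger0_norm // subr_ge0.
pose h t := phi (w t) + c * t.
suff : h b <= h a by rewrite /h; lra.
apply: abs_continuous_nonincreasing => //.
  apply: (@abs_continuous_dominated R _ _ _ a b (L + c) w id) => //.
  - by rewrite ltr_wpDr.
  - exact: abs_continuous_id.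
  - move=> s t as_ st tb.
    have -> : h t - h s = (phi (w t) - phi (w s)) + c * (t - s) by rewrite /h; lra.
    apply: (le_trans (ler_normD _ _)); rewrite normrM (ger0_norm c0).
    rewrite [leRHS]mulrDl lerD //.
      have wbs : w b <= w s by rewrite wbw ?(le_trans st).
      have wbt : w b <= w t by rewrite wbw ?(le_trans as_).
      apply: (le_trans (phi_lip _ _ wbs wbt)).
      by rewrite ler_wpM2l ?(ltW L0) // ler_wpDr.
    by rewrite ler_wpM2l // ler_wpDl.
move: aew; apply: negligibleS => t; apply: contra_not => /= H tab.
have [dw dw0] := H tab; have /andP[at_ tb] := tab.
have wt0 : 0 < w t by rewrite (lt_le_trans wb0) ?wbw.
have dw' : is_derive t 1 w (derive1 w t) by rewrite derive1E; exact: derivableP.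
have dpw : is_derive t 1 (phi \o w) (w t `^ (- theta) * derive1 w t).
  by apply: is_derive1_comp; exact: dphi.
have dh : is_derive t 1 h (w t `^ (- theta) * derive1 w t + c).
  have -> : h = (phi \o w) + (c \*: id) by apply/funext => s.
  rewrite -{2}[c]mulr1; exact: is_deriveD.
split; first by case: dh.
rewrite derive1E derive_val.
(* What remains is the differential inequality divided by the positive power of [w t]. *)
rewrite powRN mulrC -[c]opprK subr_le0 ler_pdivrMr ?powR_gt0 //.
Qed.

(** * Distances and real powers *)

Lemma dist_ge0 (R : realType) (n : nat) (y : 'rV[R]_n) (S : set 'rV[R]_n) :
  S !=set0 -> 0 <= dist y S.
Proof.
move=> [z Sz]; apply: lb_le_inf; last by move=> _ [u _ <-]; exact: sqrtr_ge0.
by exists (enorm (y - z)), z.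
Qed.

(** Solves the lower comparison of [W] with the distance for the distance. *)
Lemma le_powR_root (R : realType) (m p d B : R) : 0 < m -> 0 < p -> 0 <= d ->
  m * d `^ p <= B -> d <= (B / m) `^ p^-1.
Proof.
move=> m0 p0 d0 dB; have dB' : d `^ p <= B / m by rewrite ler_pdivlMr // mulrC.
rewrite -[leLHS]powRr1 // -(@mulfV _ p) ?gt_eqF // powRrM.
apply: ge0_ler_powR; rewrite ?nnegrE ?invr_ge0 ?(ltW p0) ?powR_ge0 //.
by rewrite (le_trans _ dB') ?powR_ge0.
Qed.

(** Applied with [r = p^-1], this bounds a [p]-th root independently of [p], as a constant [C] that
    does not see [p] requires. *)
Lemma powR_le_add1 (R : realType) (A r : R) : 0 <= A -> 0 <= r -> r <= 1 ->
  A `^ r <= 1 + A.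
Proof.
move=> A0 r0 r1; have [A1|A1] := leP 1 A.
  by rewrite (le_trans (ler1_powR A1 r1)) // lerDr.
apply: (@le_trans _ _ 1); last by rewrite lerDl.
apply: le_trans (_ : 1 `^ r <= 1); last by rewrite powR1.
by rewrite ge0_ler_powR ?nnegrE // ltW.
Qed.

(** * Decay rates for the exponents 1 and above 1 *)

(** Comparison with [phi = ln]; the case [w b = 0], where the logarithm is useless, is trivial. *)
Lemma exponential_decay (R : realType) (a b c : R) (w : R -> R) :
  a <= b -> 0 <= c -> @abs_continuous R R a b w ->
  (forall t, a <= t <= b -> 0 <= w t) ->
  {ae @lebesgue_measure R, forall t, a <= t <= b ->
     derivable w t 1 /\ derive1 w t <= - c * w t `^ 1} ->
  w b <= w a * expR (- c * (b - a)).
Proof.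
move=> ab c0 ACw w0 aew.
have wa0 : 0 <= w a by rewrite w0 ?lexx.
have [wb0|wb0] := leP (w b) 0.
  by rewrite (le_trans wb0) // mulr_ge0 ?expR_ge0.
have dln (y : R) : 0 < y -> is_derive y (1 : R) (@ln R) (y `^ (- 1)).
  by move=> y0; rewrite powR_inv1 ?ltW //; exact: is_derive1_ln.
have le01 : 0 <= 1 :> R by [].
have H := @separable_comparison R a b c 1 w (@ln R) ab c0 le01 ACw w0 wb0 dln aew.
have wba : w b <= w a.
  exact: (dissipative_nonincreasing _ _ _ _ _ _ c0 ACw aew).
have wa_gt0 := lt_le_trans wb0 wba.
rewrite -[leLHS]lnK ?posrE // -[w a]lnK ?posrE // -expRD ler_expR; lra.
Qed.

(** Comparison with the antiderivative [phi] of the power [- theta], which has the negative factor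
    [(1 - theta)^-1]. Clearing this factor bounds the power [1 - theta] of [w b] from below, and the
    decreasing power [- (theta - 1)^-1] turns that into an upper bound on [w b]. *)
Lemma polynomial_decay (R : realType) (a b c theta : R) (w : R -> R) :
  a <= b -> 0 <= c -> 1 < theta -> @abs_continuous R R a b w ->
  (forall t, a <= t <= b -> 0 <= w t) ->
  {ae @lebesgue_measure R, forall t, a <= t <= b ->
     derivable w t 1 /\ derive1 w t <= - c * w t `^ theta} ->
  w b <= if w a == 0 then 0
         else (w a `^ (1 - theta) + c * (theta - 1) * (b - a))
                `^ (- (theta - 1)^-1).
Proof.
move=> ab c0 th1 ACw w0 aew.
have q0 : 0 < theta - 1 by rewrite subr_gt0.
have wba : w b <= w a.
  exact: (dissipative_nonincreasing _ _ _ _ _ _ c0 ACw aew).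
(* Monotonicity settles [w a = 0]. The library gives 0 raised to [1 - theta] the value 0, not
   infinity, so this case has to be split off. *)
have [wa0|wa0] := eqVneq; first by rewrite -wa0.
have [wb0|wb0] := leP (w b) 0; first by rewrite (le_trans wb0) ?powR_ge0.
have wa_gt0 := lt_le_trans wb0 wba.
pose phi (y : R) := (1 - theta)^-1 * y `^ (1 - theta).
have dphi (y : R) : 0 < y -> is_derive y (1 : R) phi (y `^ (- theta)).
  move=> y0; have -> : y `^ (- theta) =
      (1 - theta)^-1 * ((1 - theta) * y `^ (1 - theta - 1)).
    rewrite mulKf; last by rewrite subr_eq0 lt_eqF.
    by congr (_ `^ _); lra.
  by apply: is_deriveZ; exact: is_derive1_powR.
have th0 : 0 <= theta by lra.
have H := separable_comparison R a b c theta w phi ab c0 th0 ACw w0 wb0 dphi aew.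
set B := w a `^ (1 - theta) + _.
have B0 : 0 < B by rewrite ltr_pwDl ?powR_gt0 // !mulr_ge0 ?subr_ge0 // ltW.
have HB : B <= w b `^ (1 - theta).
  move: H; rewrite /phi -[1 - theta]opprB invrN !mulNr.
  rewrite -(ler_pM2l q0) mulrBr !mulrN !mulVKf ?gt_eqF // /B -[1 - theta]opprB.
  lra.
have -> : w b = w b `^ (1 - theta) `^ (- (theta - 1)^-1).
  by rewrite -powRrM -[1 - theta]opprB mulrNN mulfV ?gt_eqF // powRr1 ?ltW.
rewrite !powRN lef_pV2 ?posrE ?powR_gt0 //.
by apply: ge0_ler_powR; rewrite ?nnegrE ?powR_ge0 ?invr_ge0 // ltW.
Qed.

(* C is quantified before every other datum: the constant of the polynomial
   rate depends on a, theta, m, M and W(t0, x(t0)) only. [derive1] is total, so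
   the differential inequality also asserts that the derivative exists. *)
Theorem theorem5p1 (R : realType) :
  exists C : R -> R -> R -> R -> R -> R,
  forall (n : nat) (t0 : R) (f : R -> 'rV[R]_n -> 'rV[R]_n)
    (V1 V2 : R -> 'rV[R]_n -> R) (delta m M p r : R) (x : R -> 'rV[R]_n)
    (a theta : R),
  let E := equilibria f in
  let W := lyapunov V1 V2 delta in
  let d t := dist (x t) (E t) in
  0 <= t0 ->
  admissible_field t0 f ->
  (forall t : R, t0 <= t -> E t !=set0 /\ closed (E t)) ->
  AW_regular t0 E ->
  0 < delta ->
  (forall (t : R) (y : 'rV[R]_n), 0 <= t -> 0 <= V1 t y /\ 0 <= V2 t y) ->
  (forall y, is_solution t0 f y ->
     @loc_abs_continuous R R t0 (fun t => V1 t (y t)) /\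
     @loc_abs_continuous R R t0 (fun t => V2 t (y t))) ->
  0 < m -> 0 < M -> 1 <= p -> 0 < r ->
  (forall (t : R) (y : 'rV[R]_n), t0 <= t -> dist y (E t) <= r ->
     m * dist y (E t) `^ p <= W t y /\ W t y <= M * dist y (E t) `^ p) ->
  is_solution t0 f x ->
  (forall t : R, t0 <= t -> d t <= r) ->
  0 < a -> 0 < theta ->
  {ae @lebesgue_measure R, forall t : R, t0 <= t ->
     derivable (fun s => W s (x s)) t 1 /\
     derive1 (fun s => W s (x s)) t <= - a * W t (x t) `^ theta} ->
  (theta = 1 -> forall t : R, t0 <= t ->
     W t (x t) <= W t0 (x t0) * expR (- a * (t - t0)) /\
     d t <= (M / m) `^ p^-1 * expR (- a * (t - t0) / p) * d t0) /\
  (1 < theta ->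
     (forall t : R, t0 <= t ->
        W t (x t) <=
          if W t0 (x t0) == 0 then 0
          else (W t0 (x t0) `^ (1 - theta) + a * (theta - 1) * (t - t0))
                 `^ (- (theta - 1)^-1)) /\
     0 < C a theta m M (W t0 (x t0)) /\
     forall t : R, t0 <= t ->
        d t <= C a theta m M (W t0 (x t0)) *
               (1 + t - t0) `^ (- (p * (theta - 1))^-1)).

Proof.
(* The minimum [c] satisfies [c * (1 + t - t0) <= B], with [B] the base in the bound on [W].
   Dividing by [m] and taking the [p]-th root leaves the root of a number [A], which is at most
   [1 + A]. For [W0 = 0] the powers evaluate to 0 and the constant is 1. *)
exists (fun a theta m M W0 =>
  1 + Num.min (W0 `^ (1 - theta)) (a * (theta - 1)) `^ (- (theta - 1)^-1) / m).
move=> n t0 f V1 V2 delta m M p r x a theta E W d t00 _ E0 _ delta0 V0 ACV.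
move=> m0 M0 p1 r0 WE solx dr a0 theta0 aeW.
have p0 : 0 < p := lt_le_trans ltr01 p1.
pose w t := W t (x t).
have w0 t : t0 <= t -> 0 <= w t.
  move=> /(le_trans t00)/(V0 _ (x t))[V10 V20].
  by rewrite /w /W /lyapunov addr_ge0 // mulr_ge0 // ltW.
have d0 t : t0 <= t -> 0 <= d t by move=> /E0[? _]; exact: dist_ge0.
have ACw t : t0 <= t -> @abs_continuous R R t0 t w.
  move=> t0t.
  have [AC1 AC2] := ACV x solx.
  (* The factor [1 + delta] exceeds both coefficients, 1 of [V1] and [delta] of [V2]. *)
  apply: (@abs_continuous_dominated R _ _ _ t0 t (1 + delta))
    (AC1 _ _ (lexx _) t0t) (AC2 _ _ (lexx _) t0t) _.
  - by rewrite addr_gt0.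
  - move=> s u _ su _.
    set v1 := V1 u (x u) - _; set v2 := V2 u (x u) - _.
    have -> : w u - w s = v1 + delta * v2.
      by rewrite /w /W /lyapunov /v1 /v2; lra.
    rewrite (le_trans (ler_normD _ _)) // normrM (gtr0_norm delta0).
    have := normr_ge0 v1; have := normr_ge0 v2; nra.
have aew T : {ae @lebesgue_measure R, forall t, t0 <= t <= T ->
    derivable w t 1 /\ derive1 w t <= - a * w t `^ theta}.
  by move: aeW; apply: negligibleS => s; apply: contra_not => /= H /andP[/H].
(* The assumption [d t <= r] keeps the solution where [W] and the distance are comparable. *)
have d_le t B : t0 <= t -> w t <= B -> d t <= (B / m) `^ p^-1.
  move=> t0t wB; apply: le_powR_root => //; first exact: d0.
  by have [+ _] := WE t (x t) t0t (dr t t0t) => /le_trans; apply.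
have root_p : 0 <= p^-1 by rewrite invr_ge0 ltW.
have w_nneg T t : t0 <= t <= T -> 0 <= w t by move=> /andP[/w0].
split=> [theta1 t t0t|theta1].
  have wt : w t <= w t0 * expR (- a * (t - t0)).
    apply: exponential_decay => //; [exact: ltW | exact: ACw | exact: w_nneg |].
    by rewrite theta1 in aew; exact: aew.
  split => //.
  (* The upper comparison is applied at the initial time only. *)
  have wt' : w t <= M * d t0 `^ p * expR (- a * (t - t0)).
    rewrite (le_trans wt) // ler_wpM2r ?expR_ge0 //.
    by have [] := WE t0 (x t0) (lexx _) (dr t0 (lexx _)).
  rewrite (le_trans (d_le _ _ t0t wt')) // (expRM (- a * (t - t0)) p^-1).
  have -> : M * d t0 `^ p * expR (- a * (t - t0)) / m =
     M / m * expR (- a * (t - t0)) * d t0 `^ p by lra.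
  rewrite powRM ?mulr_ge0 ?powR_ge0 ?expR_ge0 ?invr_ge0 ?(ltW m0) ?(ltW M0) //.
  rewrite powRM ?mulr_ge0 ?expR_ge0 ?invr_ge0 ?(ltW m0) ?(ltW M0) //.
  by rewrite -powRrM mulfV ?gt_eqF // powRr1 ?d0 ?lexx.
have q0 : 0 < theta - 1 by rewrite subr_gt0.
have wt t : t0 <= t -> w t <= if w t0 == 0 then 0
    else (w t0 `^ (1 - theta) + a * (theta - 1) * (t - t0))
           `^ (- (theta - 1)^-1).
  by move=> t0t; apply: polynomial_decay => //; [exact: ltW | exact: ACw | exact: w_nneg].
split; first exact: wt.
rewrite -/(w t0).
set c := Num.min _ _.
have cm0 : 0 <= c `^ (- (theta - 1)^-1) / m by rewrite divr_ge0 ?powR_ge0 ?ltW.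
split; first by rewrite ltr_pwDl.
move=> t t0t; have tau0 : 0 < 1 + t - t0 by lra.
have wtc : w t <= c `^ (- (theta - 1)^-1) * (1 + t - t0) `^ (- (theta - 1)^-1).
  rewrite (le_trans (wt t t0t)) //; have [_|wt00] := eqVneq.
    by rewrite mulr_ge0 ?powR_ge0.
  have c0 : 0 < c.
    by rewrite /c lt_min mulr_gt0 // powR_gt0 // lt_neqAle eq_sym wt00 w0.
  have c1 : c <= w t0 `^ (1 - theta) by rewrite ge_min lexx.
  have c2 : c <= a * (theta - 1) by rewrite ge_min lexx orbT.
  (* Split [c * (1 + t - t0)] into [c] and [c * (t - t0)], and bound the first by [c1], the second
     by [c2]. *)
  have cB : c * (1 + t - t0) <=
      w t0 `^ (1 - theta) + a * (theta - 1) * (t - t0) by nra.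
  rewrite -powRM ?(ltW c0) ?(ltW tau0) // !powRN lef_pV2 ?posrE; last 2 first.
  - by rewrite powR_gt0 // (lt_le_trans _ cB) ?mulr_gt0.
  - by rewrite powR_gt0 ?mulr_gt0.
  apply: ge0_ler_powR => //; rewrite ?nnegrE ?invr_ge0 ?mulr_ge0 ?(ltW c0) ?ltW //.
  by rewrite (lt_le_trans _ cB) ?mulr_gt0.
(* The [p]-th root multiplies the exponent of the time factor by [p^-1], which yields the stated
   rate. *)
rewrite (le_trans (d_le _ _ t0t wtc)) // mulrAC powRM ?powR_ge0 //.
rewrite -powRrM invfM [p^-1 * _]mulrC -mulNr ler_wpM2r ?powR_ge0 //.
by rewrite powR_le_add1 // invf_le1.
Qed.
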